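(* Let $p \ge 5$ be an integer, let $u = 2^{-p}$, and consider radix-2, precision-$p$ floating-point arithmetic with unbounded exponent range and rounding function $\mathrm{RN}$ (round to nearest, either ties-to-even or ties-to-away). Let $x$ be a floating-point number and let $n$ be a positive integer with \[ n \le \sqrt{2^{1/3}-1}\cdot 2^{p/2}. \] Define $\widehat{x}_1 = x$ and $\widehat{x}_k = \mathrm{RN}(x\cdot \widehat{x}_{k-1})$ for $2 \le k \le n$. Then \[ \left|\widehat{x}_n - x^n\right| \le (n-1)\cdot u\cdot |x|^n . \]
   Context: Radix-2, precision-$p$ floating-point (FP) numbers with unbounded exponent range: a real number is an FP number if it is either $0$ or of the form $X\cdot 2^{e-p+1}$ with $X, e$ integers and $2^{p-1}\le |X|\le 2^p-1$; $X$ is called its integral significand. The rounding unit is $u = 2^{-p}$. A round-to-nearest function $\mathrm{RN}$ maps each real $t$ to an FP number with $|\mathrm{RN}(t)-t|\le |y-t|$ for all FP numbers $y$. If two FP numbers are equally near to $t$, ties-to-even returns the one whose integral significand is even, and ties-to-away returns the one of larger absolute value. $\mathrm{RN}$ is one of these two functions, the same one throughout the computation; the statement holds for each of them. The value $\widehat{x}_n$ is what is returned by the naive power algorithm: set $y \leftarrow x$, then for $k=2,\dots,n$ set $y\leftarrow \mathrm{RN}(x\cdot y)$, and return $y$. *)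

(* Defs.v *)
From Stdlib Require Import Reals ZArith.

Open Scope R_scope.

(* For a nonzero floating-point number y the pair (X, e) is unique; X is its
   integral significand. *)
Definition has_significand (p : Z) (y : R) (X e : Z) : Prop :=
  y = IZR X * powerRZ 2 (e - p + 1)
  /\ (2 ^ (p - 1) <= Z.abs X <= 2 ^ p - 1)%Z.

Definition is_FP (p : Z) (y : R) : Prop :=
  y = 0 \/ exists X e : Z, has_significand p y X e.

Definition is_nearest (p : Z) (t y : R) : Prop :=
  is_FP p y /\ forall z : R, is_FP p z -> Rabs (y - t) <= Rabs (z - t).

Definition round_to_nearest (p : Z) (RN : R -> R) : Prop :=
  forall t : R, is_nearest p t (RN t).

(* t is a tie when it has a nearest floating-point number y other than RN t.
   Then t <> 0, and both candidates are nonzero, so RN t has a significand. *)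
Definition ties_to_even (p : Z) (RN : R -> R) : Prop :=
  forall t y : R, is_nearest p t y -> y <> RN t ->
    exists X e : Z, has_significand p (RN t) X e /\ Z.Even X.

Definition ties_to_away (p : Z) (RN : R -> R) : Prop :=
  forall t y : R, is_nearest p t y -> y <> RN t -> Rabs y < Rabs (RN t).

(* The algorithm starts at n = 1; the value at n = 0 is a placeholder. *)
Fixpoint naive_power (RN : R -> R) (x : R) (n : nat) : R :=
  match n with
  | O => 1
  | S O => x
  | S (S _ as k) => RN (x * naive_power RN x k)
  end.

(* Main.v *)
Require Import Defs.
From Stdlib Require Import Reals ZArith Lra Lia.

Open Scope R_scope.

(** The proof compares the computed powers with the recurrence
    [y (S k) = m * y k * (1 + d)], [Rabs d <= u], after dividing everything by
    a signed power of two so that [1 <= m < 2].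

    From below, Bernoulli's inequality for [(1 - u) ^ (n - 1)] is enough.  From
    above, [(1 + u) ^ (n - 1)] exceeds [1 + (n - 1) u] by about [n^2 u^2 / 2],
    so one rounding has to be better than the worst case by that much
    ([compounded_error_with_saved_step]).  A rounding of [t] in the binade
    [[2^E, 2^(E+1)]] has absolute error at most [u * 2^E], hence relative error
    at most [u / A] as soon as [t >= A * 2^E]; the choice
    [A = 1 + 3/4 * n^2 * u] saves what is needed, and the bound on [n] gives
    [A <= 6/5].

    It remains to see why such a rounding occurs ([saved_step_or_error_bound]).
    If [m^2] is not already a suitable product, then either [m^2] lies just
    above [2], and the next product, close to [m^3], is well inside [[2, 4]]
    (for [n = 2] there is a single rounding and the bound is
    immediate); or [m^2 < A], and the products grow too slowly to jump over
    [[A, 2]].  In that last case either some product falls in [[A, 2]], or all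
    of them stay in [[1, 2]], where every rounding has absolute error at most
    [u]; these errors, amplified by powers of [m], add up to at most
    [(n - 1) * u * m^n]. *)

Lemma Rabs_le_inv (a b : R) : Rabs a <= b -> - b <= a <= b.
Proof.
  intros H; pose proof (Rle_abs a); pose proof (Rle_abs (- a)) as H2.
  rewrite Rabs_Ropp in H2; lra.
Qed.

(** * Scaling by signed powers of two *)

Definition signed_pow2 (c : R) : Prop :=
  exists e : Z, c = powerRZ 2 e \/ c = - powerRZ 2 e.

Lemma pow2_pos (e : Z) : 0 < powerRZ 2 e.
Proof. apply powerRZ_lt; lra. Qed.

Lemma pow2_add (a b : Z) : powerRZ 2 (a + b) = powerRZ 2 a * powerRZ 2 b.
Proof. apply powerRZ_add; lra. Qed.

Lemma signed_pow2_neq_0 (c : R) : signed_pow2 c -> c <> 0.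
Proof. intros [e [-> | ->]]; pose proof (pow2_pos e); lra. Qed.

Lemma signed_pow2_mult (c d : R) :
  signed_pow2 c -> signed_pow2 d -> signed_pow2 (c * d).
Proof.
  intros [e He] [f Hf]; exists (e + f)%Z; rewrite pow2_add.
  destruct He as [-> | ->], Hf as [-> | ->]; (left; ring) || (right; ring).
Qed.

Lemma signed_pow2_pow (c : R) (n : nat) : signed_pow2 c -> signed_pow2 (c ^ n).
Proof.
  intros Hc; induction n as [|n IH]; simpl.
  - exists 0%Z; left; reflexivity.
  - now apply signed_pow2_mult.
Qed.

Lemma signed_pow2_inv (c : R) : signed_pow2 c -> signed_pow2 (/ c).
Proof.
  intros [e He]; exists (- e)%Z; rewrite powerRZ_neg'.
  pose proof (pow2_pos e).
  destruct He as [-> | ->]; [left | right]; field; lra.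
Qed.

Lemma is_FP_scale (p : Z) (c z : R) :
  signed_pow2 c -> is_FP p z -> is_FP p (c * z).
Proof.
  intros [e He] [-> | [X [f [-> HX]]]]; [left; ring | right].
  destruct He as [-> | ->].
  - exists X, (e + f)%Z; split; [|exact HX].
    replace (e + f - p + 1)%Z with (e + (f - p + 1))%Z by ring.
    rewrite (pow2_add e); ring.
  - exists (- X)%Z, (e + f)%Z; split; [|rewrite Z.abs_opp; exact HX].
    replace (e + f - p + 1)%Z with (e + (f - p + 1))%Z by ring.
    rewrite (pow2_add e), opp_IZR; ring.
Qed.

(** Rescaling turns a rounding function into another function, but the relation
    of being a nearest floating-point number is scale-invariant; the iteration
    is therefore normalised through this relation. *)
Lemma is_nearest_unscale (p : Z) (c t y : R) :
  signed_pow2 c -> is_nearest p (c * t) y -> is_nearest p t (y / c).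
Proof.
  intros Hc [Hy Hmin].
  pose proof (signed_pow2_neq_0 c Hc) as Hc0.
  split.
  - replace (y / c) with (/ c * y) by (unfold Rdiv; ring).
    apply is_FP_scale; [now apply signed_pow2_inv | exact Hy].
  - intros z Hz.
    apply Rmult_le_reg_l with (Rabs c); [now apply Rabs_pos_lt|].
    rewrite <- !Rabs_mult.
    replace (c * (y / c - t)) with (y - c * t) by (field; exact Hc0).
    replace (c * (z - t)) with (c * z - c * t) by ring.
    apply Hmin; now apply is_FP_scale.
Qed.

(** * Rounding to nearest inside a binade *)

Lemma IZR_pow2 (a : Z) : (0 <= a)%Z -> IZR (2 ^ a) = powerRZ 2 a.
Proof.
  intros Ha; rewrite <- (Z2Nat.id a Ha), <- pow_powerRZ, <- pow_IZR; reflexivity.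
Qed.

(** The upper end [X = 2 ^ p] is allowed: it is the first significand of the
    next binade. *)
Lemma is_FP_grid (p X E : Z) :
  (1 <= p)%Z -> (2 ^ (p - 1) <= X <= 2 ^ p)%Z ->
  is_FP p (IZR X * powerRZ 2 (E - p + 1)).
Proof.
  intros Hp HX; right.
  assert (H2 : (2 ^ p = 2 * 2 ^ (p - 1))%Z).
  { rewrite <- Z.pow_succ_r by lia; f_equal; lia. }
  assert (H0 : (0 < 2 ^ (p - 1))%Z) by (apply Z.pow_pos_nonneg; lia).
  destruct (Z.eq_dec X (2 ^ p)) as [-> | Hne].
  - exists (2 ^ (p - 1))%Z, (E + 1)%Z; split; [|lia].
    replace (E + 1 - p + 1)%Z with (1 + (E - p + 1))%Z by ring.
    rewrite (pow2_add 1), H2, mult_IZR; simpl powerRZ; ring.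
  - exists X, E; split; [reflexivity | lia].
Qed.

Lemma is_FP_pow2 (p E : Z) : (1 <= p)%Z -> is_FP p (powerRZ 2 E).
Proof.
  intros Hp.
  replace (powerRZ 2 E) with (IZR (2 ^ (p - 1)) * powerRZ 2 (E - p + 1)).
  - apply is_FP_grid; [exact Hp|].
    split; [lia | apply Z.pow_le_mono_r; lia].
  - rewrite IZR_pow2, <- pow2_add by lia; f_equal; ring.
Qed.

Lemma nearest_integer (r : R) : exists X : Z, Rabs (IZR X - r) <= / 2.
Proof.
  exists (up (r - / 2)); destruct (archimed (r - / 2)); apply Rabs_le; lra.
Qed.

(** The closed binade is a grid of floating-point numbers of spacing
    [q = 2 ^ (E - p + 1)], so some multiple of [q] at distance at most [q / 2]
    competes with [y]. *)
Lemma nearest_abs_error (p E : Z) (t y : R) :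
  (1 <= p)%Z -> is_nearest p t y ->
  powerRZ 2 E <= t <= powerRZ 2 (E + 1) ->
  Rabs (y - t) <= powerRZ 2 (- p) * powerRZ 2 E.
Proof.
  intros Hp [_ Hmin] [Hl Hu].
  set (q := powerRZ 2 (E - p + 1)).
  assert (Hq : 0 < q) by apply pow2_pos.
  assert (HEq : powerRZ 2 E = powerRZ 2 (p - 1) * q).
  { unfold q; rewrite <- pow2_add; f_equal; ring. }
  assert (HE1 : powerRZ 2 (E + 1) = powerRZ 2 p * q).
  { unfold q; rewrite <- pow2_add; f_equal; ring. }
  assert (Hhalf : powerRZ 2 (- p) * powerRZ 2 E = / 2 * q).
  { unfold q; replace (E - p + 1)%Z with (1 + (- p + E))%Z by ring.
    rewrite (pow2_add 1), pow2_add; simpl powerRZ; field. }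
  rewrite Hhalf.
  destruct (nearest_integer (t / q)) as [X HX].
  assert (Ht : t = t / q * q) by (field; lra).
  apply Rabs_le_inv in HX.
  assert (Hlo : powerRZ 2 (p - 1) <= t / q).
  { apply Rmult_le_reg_r with q; lra. }
  assert (Hhi : t / q <= powerRZ 2 p).
  { apply Rmult_le_reg_r with q; lra. }
  rewrite <- IZR_pow2 in Hlo, Hhi by lia.
  apply Rle_trans with (Rabs (IZR X * q - t)).
  - apply Hmin, is_FP_grid; [exact Hp|].
    split; apply Z.lt_succ_r, lt_IZR; unfold Z.succ; rewrite plus_IZR; lra.
  - rewrite Ht at 1; rewrite <- Rmult_minus_distr_r, Rabs_mult, (Rabs_pos_eq q)
      by lra.
    apply Rmult_le_compat_r; [lra | apply Rabs_le; lra].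
Qed.

(** [2 ^ E] is itself a floating-point number, so a value below it would be
    farther from [t]. *)
Lemma nearest_ge_pow2 (p E : Z) (t y : R) :
  (1 <= p)%Z -> is_nearest p t y -> powerRZ 2 E <= t -> powerRZ 2 E <= y.
Proof.
  intros Hp [_ Hmin] Ht.
  pose proof (Hmin _ (is_FP_pow2 p E Hp)) as H.
  rewrite (Rabs_left1 (powerRZ 2 E - t)) in H by lra.
  apply Rabs_le_inv in H; lra.
Qed.

Lemma binade_exists (t : R) :
  0 < t -> exists E : Z, powerRZ 2 E <= t <= powerRZ 2 (E + 1).
Proof.
  intros Ht.
  assert (Hs : exists s, t = Rpower 2 s).
  { exists (ln t / ln 2); unfold Rpower.
    replace (ln t / ln 2 * ln 2) with (ln t).
    - now rewrite exp_ln.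
    - field; apply ln_neq_0; lra. }
  destruct Hs as [s ->]; exists (up s - 1)%Z.
  destruct (archimed s) as [Hlo Hhi].
  rewrite Z.sub_add, !powerRZ_Rpower, minus_IZR by lra.
  split; apply Rle_Rpower; lra.
Qed.

Lemma nearest_rel_error (p : Z) (t y : R) :
  (1 <= p)%Z -> 0 < t -> is_nearest p t y ->
  Rabs (y - t) <= powerRZ 2 (- p) * t.
Proof.
  intros Hp Ht Hy.
  destruct (binade_exists t Ht) as [E HE].
  apply Rle_trans with (1 := nearest_abs_error p E t y Hp Hy HE).
  apply Rmult_le_compat_l; [left; apply pow2_pos | apply HE].
Qed.

(** * Accumulation of relative errors *)

Lemma compounded_lower_bound (u m : R) (y : nat -> R) (k : nat) :
  0 <= u <= 1 -> 0 < m -> y 0%nat = m ->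
  (forall i, m * y i * (1 - u) <= y (S i)) ->
  m ^ S k * (1 - INR k * u) <= y k.
Proof.
  intros Hu Hm H0 Hstep.
  induction k as [|k IH]; [simpl; lra|].
  apply Rle_trans with (2 := Hstep k).
  assert (Hp : 0 < m ^ S (S k)) by (now apply pow_lt).
  apply Rle_trans with (m * (m ^ S k * (1 - INR k * u)) * (1 - u)).
  - rewrite S_INR.
    replace (m * (m ^ S k * (1 - INR k * u)) * (1 - u))
      with (m ^ S (S k) * ((1 - INR k * u) * (1 - u))) by (simpl; ring).
    apply Rmult_le_compat_l; [lra|].
    pose proof (pos_INR k).
    assert (0 <= INR k * u * u) by (repeat apply Rmult_le_pos; lra).
    lra.
  - apply Rmult_le_compat_r; [lra|].
    apply Rmult_le_compat_l; [lra | exact IH].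
Qed.

Lemma compounded_upper_bound (u m : R) (y : nat -> R) (k : nat) :
  0 <= u -> 0 < m -> y 0%nat = m ->
  (forall i, y (S i) <= m * y i * (1 + u)) ->
  y k <= m ^ S k * (1 + u) ^ k.
Proof.
  intros Hu Hm H0 Hstep.
  induction k as [|k IH]; [simpl; lra|].
  apply Rle_trans with (1 := Hstep k).
  replace (m ^ S (S k) * (1 + u) ^ S k)
    with (m * (m ^ S k * (1 + u) ^ k) * (1 + u)) by (simpl; ring).
  apply Rmult_le_compat_r; [lra|].
  apply Rmult_le_compat_l; [lra | exact IH].
Qed.

Lemma compounded_upper_bound_with_step
    (u v m : R) (y : nat -> R) (i d : nat) :
  0 <= u -> 0 <= v -> 0 < m -> y 0%nat = m ->
  (forall j, y (S j) <= m * y j * (1 + u)) ->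
  y (S i) <= m * y i * (1 + v) ->
  y (S (i + d)) <= m ^ S (S (i + d)) * ((1 + u) ^ (i + d) * (1 + v)).
Proof.
  intros Hu Hv Hm H0 Hstep Hsave.
  induction d as [|d IH].
  - rewrite Nat.add_0_r.
    apply Rle_trans with (1 := Hsave).
    replace (m ^ S (S i) * ((1 + u) ^ i * (1 + v)))
      with (m * (m ^ S i * (1 + u) ^ i) * (1 + v)) by (simpl; ring).
    apply Rmult_le_compat_r; [lra|].
    apply Rmult_le_compat_l; [lra|].
    now apply compounded_upper_bound.
  - rewrite Nat.add_succ_r.
    apply Rle_trans with (1 := Hstep _).
    replace (m ^ S (S (S (i + d))) * ((1 + u) ^ S (i + d) * (1 + v)))
      with (m * (m ^ S (S (i + d)) * ((1 + u) ^ (i + d) * (1 + v))) * (1 + u))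
      by (simpl; ring).
    apply Rmult_le_compat_r; [lra|].
    apply Rmult_le_compat_l; [lra | exact IH].
Qed.

(** The induction closes exactly because [j^2 * u <= 1] lets the cubic term
    [j^2 * u^3 / 2] fit into the [u^2 / 2] by which [(j + 1)^2 / 2] exceeds
    [j^2 / 2 + j]. *)
Lemma pow_1_plus_le_quadratic (u : R) (j : nat) :
  0 <= u -> INR j ^ 2 * u <= 1 ->
  (1 + u) ^ j <= 1 + INR j * u + INR j ^ 2 * u ^ 2 / 2.
Proof.
  intros Hu; induction j as [|j IH]; intros Hj; [simpl; lra|].
  rewrite S_INR in *; pose proof (pos_INR j) as Hj0.
  assert (Hj1 : INR j ^ 2 * u <= 1).
  { apply Rle_trans with (2 := Hj), Rmult_le_compat_r; nra. }
  apply Rle_trans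
    with ((1 + u) * (1 + INR j * u + INR j ^ 2 * u ^ 2 / 2)).
  - simpl pow at 1; apply Rmult_le_compat_l; [lra | now apply IH].
  - assert (INR j ^ 2 * u * u ^ 2 <= 1 * u ^ 2)
      by (apply Rmult_le_compat_r; [apply pow2_ge_0 | exact Hj1]).
    nra.
Qed.

(** To second order the left side is at most
    [1 + (j + 1) u + (j^2 / 2 + j - s) u^2], where [s * u^2 = u - u / A] is the
    saving of the last factor: [s = 3/4 * (j + 2)^2 / A] is at least [5/8 * (j + 2)^2] because [A <= 6/5]. *)
Lemma compounded_error_with_saved_step (u A : R) (j : nat) :
  0 <= u -> A = 1 + 3 / 4 * (INR j + 2) ^ 2 * u -> A <= 6 / 5 ->
  (1 + u) ^ j * (1 + u / A) <= 1 + (INR j + 1) * u.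
Proof.
  intros Hu HA HA1; pose proof (pos_INR j) as Hj.
  set (b := INR j) in *.
  set (w := (b + 2) ^ 2 * u).
  assert (Hw0 : 0 <= w) by (apply Rmult_le_pos; [apply pow2_ge_0 | lra]).
  assert (HAw : A = 1 + 3 / 4 * w) by (unfold w; lra).
  assert (Hbw : b ^ 2 * u <= w)
    by (apply Rmult_le_compat_r; [lra | nra]).
  assert (Hv : u / A <= u - 5 / 8 * w * u).
  { apply Rmult_le_reg_r with A; [lra|].
    replace (u / A * A) with u by (field; lra).
    assert (0 <= w * u) by (apply Rmult_le_pos; lra).
    rewrite HAw; nra. }
  assert (Hv0 : 0 <= u / A) by (apply Rle_mult_inv_pos; lra).
  pose proof (pow_1_plus_le_quadratic u j Hu ltac:(fold b; lra)) as Hq.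
  fold b in Hq.
  assert (Hq0 : 0 <= 1 + b * u + b ^ 2 * u ^ 2 / 2) by nra.
  apply Rle_trans with ((1 + b * u + b ^ 2 * u ^ 2 / 2)
                        * (1 + (u - 5 / 8 * w * u))).
  { apply Rmult_le_compat; try lra. apply pow_le; lra. }
  assert (Hc : b ^ 2 * u * u ^ 2 <= u ^ 2)
    by (rewrite <- (Rmult_1_l (u ^ 2)) at 2;
        apply Rmult_le_compat_r; [apply pow2_ge_0 | lra]).
  assert (Hwu : w * u = (b + 2) ^ 2 * u ^ 2) by (unfold w; ring).
  assert (0 <= w * u * (b * u + b ^ 2 * u ^ 2 / 2))
    by (apply Rmult_le_pos; nra).
  assert (0 <= b * u ^ 2) by (apply Rmult_le_pos; nra).
  assert (0 <= b ^ 2 * u ^ 2) by (apply Rmult_le_pos; nra).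
  nra.
Qed.

(** * Iterated rounded products of a normalised factor *)

(** When all products stay in [[1, 2]] the absolute errors, at most [u] each,
    are all that has to be added up. *)
Lemma error_bound_step_unit_binade (u m y y' : R) (k : nat) :
  0 <= u -> 1 <= m ->
  Rabs (y' - m * y) <= u ->
  Rabs (y - m ^ S k) <= INR k * u * m ^ S k ->
  Rabs (y' - m ^ S (S k)) <= INR (S k) * u * m ^ S (S k).
Proof.
  intros Hu Hm Hy' Hy.
  replace (y' - m ^ S (S k)) with ((y' - m * y) + m * (y - m ^ S k))
    by (simpl; ring).
  apply Rle_trans with (1 := Rabs_triang _ _).
  rewrite Rabs_mult, (Rabs_pos_eq m), S_INR by lra.
  assert (H1 : 1 <= m ^ S (S k)) by (now apply pow_R1_Rle).
  assert (H2 : m * Rabs (y - m ^ S k) <= m * (INR k * u * m ^ S k))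
    by (apply Rmult_le_compat_l; lra).
  replace (m * (INR k * u * m ^ S k)) with (INR k * u * m ^ S (S k)) in H2
    by (simpl; ring).
  assert (u * 1 <= u * m ^ S (S k)) by (apply Rmult_le_compat_l; lra).
  lra.
Qed.

Section NormalisedPowers.

Variables (p : Z) (m : R) (y : nat -> R).
Hypothesis p_ge_5 : (5 <= p)%Z.
Hypothesis m_ge_1 : 1 <= m.
Hypothesis m_lt_2 : m < 2.
Hypothesis y_0 : y 0%nat = m.
Hypothesis y_S : forall k, is_nearest p (m * y k) (y (S k)).

Let u := powerRZ 2 (- p).

Lemma unit_roundoff_bounds : 0 < u <= / 32.
Proof.
  split; [apply pow2_pos|].
  unfold u; replace (- p)%Z with (- 5 + - (p - 5))%Z by ring.
  rewrite pow2_add, !powerRZ_neg'.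
  rewrite <- (IZR_pow2 (p - 5)) by lia.
  assert (H : 1 <= IZR (2 ^ (p - 5))).
  { apply IZR_le. assert (0 < 2 ^ (p - 5))%Z by (apply Z.pow_pos_nonneg; lia).
    lia. }
  assert (/ IZR (2 ^ (p - 5)) <= 1)
    by (rewrite <- Rinv_1; apply Rinv_le_contravar; lra).
  simpl powerRZ; lra.
Qed.

Lemma normalised_pos (k : nat) : 0 < y k.
Proof.
  pose proof unit_roundoff_bounds.
  induction k as [|k IH]; [lra|].
  assert (Ht : 0 < m * y k) by (apply Rmult_lt_0_compat; lra).
  pose proof (nearest_rel_error p _ _ ltac:(lia) Ht (y_S k)) as H1.
  fold u in H1; apply Rabs_le_inv in H1.
  nra.
Qed.

Lemma normalised_step (k : nat) :
  m * y k * (1 - u) <= y (S k) <= m * y k * (1 + u).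
Proof.
  assert (Ht : 0 < m * y k)
    by (apply Rmult_lt_0_compat; [lra | apply normalised_pos]).
  pose proof (nearest_rel_error p _ _ ltac:(lia) Ht (y_S k)) as H1.
  fold u in H1; apply Rabs_le_inv in H1.
  split; lra.
Qed.

Definition in_upper_binade (A t : R) : Prop :=
  exists E : Z, A * powerRZ 2 E <= t <= powerRZ 2 (E + 1).

Lemma saved_step (A : R) (k : nat) :
  1 <= A -> in_upper_binade A (m * y k) ->
  y (S k) <= m * y k * (1 + u / A).
Proof.
  intros HA [E [Hlo Hhi]].
  pose proof (pow2_pos E); pose proof unit_roundoff_bounds.
  assert (HE : powerRZ 2 E <= m * y k) by nra.
  pose proof (nearest_abs_error p E _ _ ltac:(lia) (y_S k) (conj HE Hhi)) as H1.
  fold u in H1; apply Rabs_le_inv in H1.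
  assert (H2 : u * powerRZ 2 E <= u / A * (m * y k)).
  { replace (u * powerRZ 2 E) with (u / A * (A * powerRZ 2 E)) by (field; lra).
    apply Rmult_le_compat_l; [apply Rle_mult_inv_pos; lra | exact Hlo]. }
  lra.
Qed.

(** The bounds [1 <= y k <= A + u] keep the next product in [[1, 2]]. *)
Lemma slow_growth (A : R) (k : nat) :
  1 <= A <= 6 / 5 -> m * m < A ->
  (exists i, (i < k)%nat /\ in_upper_binade A (m * y i))
  \/ (1 <= y k <= A + u
      /\ Rabs (y k - m ^ S k) <= INR k * u * m ^ S k).
Proof.
  intros HA Hm2; pose proof unit_roundoff_bounds as Hu.
  induction k as [|k [[i [Hi Hup]] | [[Hy1 Hy2] Herr]]].
  - right; rewrite y_0; split; [split; nra|].
    rewrite pow_1, Rminus_diag, Rabs_R0; simpl; lra.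
  - left; exists i; split; [lia | exact Hup].
  - assert (Ht1 : 1 <= m * y k) by nra.
    assert (Hm : m <= 11 / 10) by nra.
    assert (Ht2 : m * y k <= 2) by nra.
    destruct (Rle_or_lt A (m * y k)) as [HAt | HAt].
    + left; exists k; split; [lia|].
      exists 0%Z; simpl; lra.
    + right.
      assert (Hb : powerRZ 2 0 <= m * y k <= powerRZ 2 (0 + 1))
        by (simpl; lra).
      pose proof (nearest_ge_pow2 p 0 _ _ ltac:(lia) (y_S k) (proj1 Hb)) as Hge.
      pose proof (nearest_abs_error p 0 _ _ ltac:(lia) (y_S k) Hb) as Habs.
      fold u in Habs; simpl powerRZ in Hge, Habs; rewrite Rmult_1_r in Habs.
      split.
      * apply Rabs_le_inv in Habs; lra.
      * apply error_bound_step_unit_binade with (y k); lra.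
Qed.

Lemma saved_step_or_error_bound (A : R) (k : nat) :
  1 <= A <= 6 / 5 ->
  (exists i, (i < k)%nat /\ in_upper_binade A (m * y i))
  \/ Rabs (y k - m ^ S k) <= INR k * u * m ^ S k.
Proof.
  intros HA; pose proof unit_roundoff_bounds as Hu.
  destruct (Rlt_or_le (m * m) A) as [Hslow | HmA].
  { destruct (slow_growth A k HA Hslow) as [H | [_ H]]; auto. }
  destruct k as [|k].
  { right; rewrite y_0, pow_1, Rminus_diag, Rabs_R0; simpl; lra. }
  destruct (Rle_or_lt (m * m) 2) as [Hle2 | Hgt2].
  { left; exists 0%nat; split; [lia|].
    exists 0%Z; rewrite y_0; simpl; lra. }
  destruct (Rle_or_lt (2 * A) (m * m)) as [H2A | H2A].
  { left; exists 0%nat; split; [lia|].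
    exists 1%Z; rewrite y_0; simpl; nra. }
  pose proof (normalised_step 0) as Hy1; rewrite y_0 in Hy1.
  destruct k as [|k].
  - right; simpl; apply Rabs_le; lra.
  - left; exists 1%nat; split; [lia|].
    (* The product is about m^3, with sqrt 2 < m <= sqrt (12/5) *)
    exists 1%Z; simpl.
    assert (Hm1 : 141 / 100 <= m) by nra.
    assert (Hm2 : m <= 155 / 100) by nra.
    assert (Hlo : 193 / 100 <= y 1%nat) by nra.
    assert (Hhi : y 1%nat <= 25 / 10) by nra.
    split; nra.
Qed.

Lemma normalised_powers_error (k : nat) :
  (INR k + 1) ^ 2 * u <= 4 / 15 ->
  Rabs (y k - m ^ S k) <= INR k * u * m ^ S k.
Proof.
  intros Hk; pose proof unit_roundoff_bounds as Hu.
  assert (Hp : 0 < m ^ S k) by (apply pow_lt; lra).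
  set (A := 1 + 3 / 4 * (INR k + 1) ^ 2 * u).
  assert (HA : 1 <= A <= 6 / 5).
  { assert (0 <= (INR k + 1) ^ 2 * u)
      by (apply Rmult_le_pos; [apply pow2_ge_0 | lra]).
    unfold A; lra. }
  destruct (saved_step_or_error_bound A k HA) as [[i [Hi Hup]] | H]; [|exact H].
  pose proof (saved_step A i (proj1 HA) Hup) as Hsave.
  pose proof (compounded_lower_bound u m y k ltac:(lra) ltac:(lra) y_0
                (fun i => proj1 (normalised_step i))) as Hlow.
  assert (Hv : 0 <= u / A) by (apply Rle_mult_inv_pos; lra).
  pose proof (compounded_upper_bound_with_step u (u / A) m y i (k - S i)
                ltac:(lra) Hv ltac:(lra) y_0
                (fun i => proj2 (normalised_step i)) Hsave) as Hupp.
  replace (S (i + (k - S i))) with k in Hupp by lia.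
  assert (Hj : INR (i + (k - S i)) + 1 = INR k).
  { rewrite <- S_INR; f_equal; lia. }
  assert (Hcomp : (1 + u) ^ (i + (k - S i)) * (1 + u / A) <= 1 + INR k * u).
  { rewrite <- Hj; apply compounded_error_with_saved_step; [lra | | lra].
    unfold A; rewrite <- Hj; ring. }
  apply Rabs_le; split; [nra|].
  assert (m ^ S k * ((1 + u) ^ (i + (k - S i)) * (1 + u / A))
          <= m ^ S k * (1 + INR k * u))
    by (apply Rmult_le_compat_l; lra).
  lra.
Qed.

End NormalisedPowers.

(** * Floating-point powers *)

Lemma FP_normalise (p : Z) (x : R) :
  (1 <= p)%Z -> is_FP p x -> x <> 0 ->
  exists c m, signed_pow2 c /\ x = c * m /\ 1 <= m < 2.
Proof.
  intros Hp [-> | [X [e [-> HX]]]] Hx; [now contradict Hx|].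
  set (N := powerRZ 2 (p - 1)).
  assert (HN : 0 < N) by apply pow2_pos.
  assert (He : powerRZ 2 e = N * powerRZ 2 (e - p + 1)).
  { unfold N; rewrite <- pow2_add; f_equal; ring. }
  assert (HNX : IZR (2 ^ (p - 1)) = N) by (apply IZR_pow2; lia).
  assert (H2N : IZR (2 ^ p) = 2 * N).
  { rewrite IZR_pow2 by lia; unfold N.
    replace p with (1 + (p - 1))%Z at 1 by ring.
    rewrite pow2_add; simpl powerRZ; ring. }
  assert (Hm : 1 <= IZR (Z.abs X) / N < 2).
  { assert (H1 : N <= IZR (Z.abs X)) by (rewrite <- HNX; apply IZR_le; lia).
    assert (H2 : IZR (Z.abs X) < 2 * N) by (rewrite <- H2N; apply IZR_lt; lia).
    split.
    - apply Rmult_le_reg_r with N; [exact HN|].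
      replace (IZR (Z.abs X) / N * N) with (IZR (Z.abs X)) by (field; lra); lra.
    - apply Rmult_lt_reg_r with N; [exact HN|].
      replace (IZR (Z.abs X) / N * N) with (IZR (Z.abs X)) by (field; lra); lra.
  }
  destruct (Z.abs_spec X) as [[_ HXe] | [_ HXe]]; rewrite HXe in Hm.
  - exists (powerRZ 2 e), (IZR X / N); split; [exists e; now left|].
    split; [rewrite He; field; lra | exact Hm].
  - exists (- powerRZ 2 e), (IZR (- X) / N); split; [exists e; now right|].
    split; [rewrite He, opp_IZR; field; lra | exact Hm].
Qed.

(** [4/15] is a rational just above [2^(1/3) - 1 = 0.2599...], chosen so that
    the threshold [1 + 3/4 * 4/15] is exactly [6/5]. *)
Lemma exponent_bound (p : Z) (n : nat) :
  INR n <= sqrt (Rpower 2 (1 / 3) - 1) * Rpower 2 (IZR p / 2) ->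
  INR n ^ 2 * powerRZ 2 (- p) <= 4 / 15.
Proof.
  intros Hn.
  set (h := Rpower 2 (1 / 3)) in *.
  assert (Hh3 : h ^ 3 = 2).
  { unfold h; rewrite <- Rpower_pow by apply exp_pos.
    rewrite Rpower_mult; simpl INR.
    replace (1 / 3 * (1 + 1 + 1)) with 1 by field.
    apply Rpower_1; lra. }
  assert (Hh0 : 0 < h) by apply exp_pos.
  assert (Hh1 : 1 <= h) by nra.
  assert (Hh2 : h <= 19 / 15) by nra.
  set (g := Rpower 2 (IZR p / 2)) in *.
  assert (Hg2 : g ^ 2 = powerRZ 2 p).
  { unfold g; rewrite powerRZ_Rpower by lra.
    simpl; rewrite Rmult_1_r, <- Rpower_plus; f_equal; field. }
  assert (Hsq : INR n ^ 2 <= (h - 1) * powerRZ 2 p).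
  { rewrite <- Hg2, <- (pow2_sqrt (h - 1)), <- Rpow_mult_distr by lra.
    apply pow_incr; split; [apply pos_INR | exact Hn]. }
  rewrite powerRZ_neg'.
  pose proof (pow2_pos p).
  apply Rmult_le_reg_r with (powerRZ 2 p); [lra|].
  replace (INR n ^ 2 * / powerRZ 2 p * powerRZ 2 p) with (INR n ^ 2)
    by (field; lra).
  nra.
Qed.

Lemma round_to_nearest_0 (p : Z) (RN : R -> R) :
  round_to_nearest p RN -> RN 0 = 0.
Proof.
  intros HRN; destruct (HRN 0) as [_ H].
  specialize (H 0 (or_introl eq_refl)).
  rewrite !Rminus_0_r, Rabs_R0 in H.
  destruct (Req_dec (RN 0) 0) as [E | E]; [exact E|].
  pose proof (Rabs_pos_lt _ E); lra.
Qed.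

Theorem theorem2 (p : Z) (hp : (5 <= p)%Z) (RN : R -> R)
    (hRN : round_to_nearest p RN)
    (hties : ties_to_even p RN \/ ties_to_away p RN)
    (x : R) (hx : is_FP p x) (n : nat) (hn1 : (1 <= n)%nat)
    (hn : INR n <= sqrt (Rpower 2 (1 / 3) - 1) * Rpower 2 (IZR p / 2)) :
  Rabs (naive_power RN x n - x ^ n)
    <= (INR n - 1) * powerRZ 2 (- p) * Rabs x ^ n.
Proof.
  destruct n as [|k]; [lia|].
  apply exponent_bound in hn.
  destruct (Req_dec x 0) as [-> | Hx0].
  - assert (Hz : naive_power RN 0 (S k) = 0).
    { destruct k as [|k]; [reflexivity|].
      change (RN (0 * naive_power RN 0 (S k)) = 0).
      rewrite Rmult_0_l; now apply round_to_nearest_0 with p. }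
    rewrite Hz, Rabs_R0, pow_i, Rminus_0_r, Rabs_R0 by lia; lra.
  - destruct (FP_normalise p x ltac:(lia) hx Hx0) as [c [m [Hc [Hxc Hm]]]].
    pose proof (signed_pow2_neq_0 c Hc) as Hc0.
    set (y k := naive_power RN x (S k) / c ^ S k).
    assert (Hy0 : y 0%nat = m).
    { unfold y; simpl; rewrite Hxc; field; exact Hc0. }
    assert (HyS : forall k, is_nearest p (m * y k) (y (S k))).
    { intros i; apply is_nearest_unscale; [now apply signed_pow2_pow|].
      replace (c ^ S (S i) * (m * y i)) with (x * naive_power RN x (S i)).
      - apply hRN.
      - unfold y; rewrite Hxc at 1; simpl pow; field.
        split; [now apply pow_nonzero | exact Hc0]. }
    rewrite S_INR in *.
    pose proof (normalised_powers_error p m y hp ltac:(lra) ltac:(lra)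
                  Hy0 HyS k hn) as H.
    assert (Hck : c ^ S k <> 0) by (now apply pow_nonzero).
    replace (naive_power RN x (S k) - x ^ S k)
      with (c ^ S k * (y k - m ^ S k)).
    + rewrite Rabs_mult, Hxc, (Rabs_mult c), Rpow_mult_distr, (RPow_abs c).
      rewrite (Rabs_pos_eq m) by lra.
      replace (INR k + 1 - 1) with (INR k) by ring.
      apply Rmult_le_compat_l with (r := Rabs (c ^ S k)) in H;
        [lra | apply Rabs_pos].
    + unfold y; rewrite Hxc at 3; rewrite Rpow_mult_distr; field; exact Hck.
Qed.
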